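(* Let $d\ge1$, $\lambda,\gamma>0$ and $K\ge0$. Define $$b:=\frac{K+1+(K+2)^2}{\lambda},\quad \varsigma:=b^2+1,\quad q_1:=b-\lambda,\quad q_2:=\lambda\varsigma-2\lambda+\gamma b,\quad A_0:=\frac{2\lambda b+2(q_1^2+q_2^2)+1}{\gamma},$$ $$M:=\begin{pmatrix}1&1&0\\1&2&b\\0&b&\varsigma\end{pmatrix}\otimes I_d .$$ Then $M$ is positive definite. Moreover, for every symmetric $Q\in\mathbb R^{d\times d}$ with $\|Q\|_{\rm op}\le K$, setting $$J_Q:=\begin{pmatrix}0&-I_d&0\\Q&0&-\lambda I_d\\0&\lambda I_d&-\gamma I_d\end{pmatrix},\qquad P_z:=\operatorname{diag}(0,0,I_d),$$ one has $$-J_QM-MJ_Q^\top+A_0\gamma P_z\succeq\frac12I_{3d}.$$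
   Context: Matrices act on $\mathbb R^{3d}=\mathbb R^d\times\mathbb R^d\times\mathbb R^d$ in $d\times d$ blocks; $A\succeq B$ is the Loewner order on symmetric matrices. *)

(* Defs.v *)
From HB Require Import structures.
From mathcomp Require Import all_boot all_order all_algebra.
From mathcomp Require Import all_classical all_reals.
From mathcomp.real_closed Require Export mxtens.

Set Implicit Arguments.
Unset Strict Implicit.
Unset Printing Implicit Defensive.

Import Order.TTheory GRing.Theory Num.Theory.

Local Open Scope classical_set_scope.
Local Open Scope ring_scope.

Section Matrices.
Variable R : realType.

Definition enorm n (x : 'cV[R]_n) : R := Num.sqrt (\sum_i x i 0 ^+ 2).

(* [sup] ranges over a nonempty bounded set here, so it is a true supremum. *)
Definition opnorm m n (A : 'M[R]_(m, n)) : R :=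
  sup [set enorm (A *m x) | x in [set x : 'cV[R]_n | enorm x <= 1]].

Definition qform n (A : 'M[R]_n) (x : 'cV[R]_n) : R := (x^T *m A *m x) 0 0.

Definition posdefmx n (A : 'M[R]_n) : Prop :=
  A \is symmetricmx /\ forall x : 'cV[R]_n, x != 0 -> 0 < qform A x.

Definition possemidefmx n (A : 'M[R]_n) : Prop :=
  A \is symmetricmx /\ forall x : 'cV[R]_n, 0 <= qform A x.

Definition loewner_ge n (A B : 'M[R]_n) : Prop :=
  [/\ A \is symmetricmx, B \is symmetricmx & possemidefmx (A - B)].

End Matrices.

Definition mx33 (T : Type) (a00 a01 a02 a10 a11 a12 a20 a21 a22 : T) :
    'M[T]_(3, 3) :=
  \matrix_(i < 3, j < 3)
    nth a00 (nth [::] [:: [:: a00; a01; a02];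
                          [:: a10; a11; a12];
                          [:: a20; a21; a22]] i) j.

(* The block index comes first, as in [tensmx]: entry (r, s) of block (i, j)
   sits at row [mxtens_index (i, r)] and column [mxtens_index (j, s)]. *)
Definition flattenmx (T : Type) m n p q (B : 'M['M[T]_(p, q)]_(m, n)) :
    'M[T]_(m * p, n * q) :=
  \matrix_(k, l)
    B (mxtens_unindex k).1 (mxtens_unindex l).1
      (mxtens_unindex k).2 (mxtens_unindex l).2.

(* Main.v *)
Require Import Defs.
From HB Require Import structures.
From mathcomp Require Import all_boot all_order all_algebra.
From mathcomp Require Import all_classical all_reals.
From mathcomp Require Import ring lra.

Set Implicit Arguments.
Unset Strict Implicit.
Unset Printing Implicit Defensive.

Import Order.TTheory GRing.Theory Num.Theory.

Local Open Scope ring_scope.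

(** Write a vector of R^(3d) as (x, y, z) and put w = Q y. The form of M is
    |x + y|^2 + |y + b z|^2 + |z|^2. The form of - J M - M J^T is
    - 2 <M X, J^T X>, a sum over coordinates. Completing squares absorbs the
    cross terms in x, w, z coordinatewise, at the cost of |2 y - w|^2 and of
    multiples of |z|^2 compensated by A_0 gam. What remains in y and w is
    controlled by |w| <= K |y| and the choice lam b = K + 1 + (K + 2)^2. *)

(** * Inner products and block coordinates *)

Definition dot (R : realType) n (u v : 'cV[R]_n) : R := (u^T *m v) 0 0.

Definition blk (R : realType) m d (i : 'I_m) (X : 'cV[R]_(m * d)) : 'cV[R]_d :=
  \col_r X (mxtens_index (i, r)) 0.

Lemma symmetricmxE (R : realType) n (A : 'M[R]_n) :
  (A \is symmetricmx) = (A == A^T).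
Proof. by rewrite is_hermitianmxE expr0 scale1r map_mx_id. Qed.

Lemma dotE (R : realType) n (u v : 'cV[R]_n) :
  dot u v = \sum_i u i 0 * v i 0.
Proof. by rewrite /dot mxE; apply: eq_bigr => i _; rewrite mxE. Qed.

Lemma enormE (R : realType) n (u : 'cV[R]_n) :
  enorm u = Num.sqrt (dot u u).
Proof. by rewrite dotE. Qed.

Lemma dot_ge0 (R : realType) n (u : 'cV[R]_n) : 0 <= dot u u.
Proof. by rewrite dotE sumr_ge0 // => i _; rewrite -expr2 sqr_ge0. Qed.

Lemma dotr0 (R : realType) n (u : 'cV[R]_n) : dot u 0 = 0.
Proof. by rewrite /dot mulmx0 mxE. Qed.

Lemma dot_eq0 (R : realType) n (u : 'cV[R]_n) : (dot u u == 0) = (u == 0).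
Proof.
apply/eqP/eqP => [|->]; last by rewrite /dot mulmx0 mxE.
rewrite dotE => /psumr_eq0P u0; apply/matrixP => i j; rewrite ord1 mxE.
apply/eqP; rewrite -sqrf_eq0 expr2 u0 // => k _.
by rewrite -expr2 sqr_ge0.
Qed.

Lemma dotC (R : realType) n (u v : 'cV[R]_n) : dot u v = dot v u.
Proof. by rewrite !dotE; apply: eq_bigr => i _; rewrite mulrC. Qed.

(** The bijection [mxtens_index] between pairs and ['I_(m * d)] turns the single sum into a double
    one. *)
Lemma dot_blk (R : realType) m d (u v : 'cV[R]_(m * d)) :
  dot u v = \sum_i dot (blk i u) (blk i v).
Proof.
rewrite dotE (reindex (@mxtens_index m d)) /=; last first.
  exists (@mxtens_unindex m d) => k _; last by rewrite mxtens_unindexK.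
  by case: k => i r; rewrite mxtens_indexK.
transitivity (\sum_i \sum_r
  u (mxtens_index (i, r)) 0 * v (mxtens_index (i, r)) 0).
  by rewrite pair_bigA; apply: eq_bigr => -[i r].
by apply: eq_bigr => i _; rewrite dotE; apply: eq_bigr => r _; rewrite !mxE.
Qed.

Lemma blk_flattenmx (R : realType) m d (B : 'M['M[R]_d]_m)
    (X : 'cV[R]_(m * d)) i :
  blk i (flattenmx B *m X) = \sum_j B i j *m blk j X.
Proof.
apply/matrixP => r s; rewrite ord1 !mxE summxE.
transitivity (\sum_j \sum_t
  B i j r t * X (mxtens_index (j, t)) 0); last first.
  by apply: eq_bigr => j _; rewrite mxE; apply: eq_bigr => t _; rewrite mxE.
rewrite pair_bigA /= (reindex (@mxtens_index m d)) /=; last first.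
  exists (@mxtens_unindex m d) => k _; last by rewrite mxtens_unindexK.
  by case: k => j t; rewrite mxtens_indexK.
by apply: eq_bigr => -[j t] _; rewrite mxE !mxtens_indexK.
Qed.

(** Presents [M] as a flattened block matrix, so that [blk_flattenmx] computes its action too. *)
Lemma tensmx1 (R : realType) m d (A : 'M[R]_m) :
  tensmx A (1%:M : 'M[R]_d) = flattenmx (\matrix_(i, j) (A i j)%:M).
Proof. by apply/matrixP => k l; rewrite !mxE mulr_natr. Qed.

Lemma trmx_flattenmx (R : realType) m d (B : 'M['M[R]_d]_m) :
  (flattenmx B)^T = flattenmx (\matrix_(i, j) (B j i)^T).
Proof. by apply/matrixP => k l; rewrite !mxE. Qed.

Lemma blk_eq0 (R : realType) m d (X : 'cV[R]_(m * d)) :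
  (forall i, blk i X = 0) -> X = 0.
Proof.
move=> X0; apply/matrixP => k l; case: (mxtens_indexP k) => i r.
by have := congr1 (fun Y : 'cV[R]_d => Y r 0) (X0 i); rewrite !mxE ord1.
Qed.

(** * Operator norm bounds *)

Lemma has_ubound_opnorm (R : realType) m n (A : 'M[R]_(m, n)) :
  has_ubound [set enorm (A *m x) | x in [set x : 'cV[R]_n | enorm x <= 1]].
Proof.
(* On the unit ball every coordinate of [x] is at most 1 in absolute value, so each entry of
   [A *m x] is bounded by the absolute row sum. *)
exists (Num.sqrt (\sum_i (\sum_j `|A i j|) ^+ 2)) => _ [x /= x1 <-].
rewrite ler_sqrt; last by apply: sumr_ge0 => i _; apply: sqr_ge0.
apply: ler_sum => i _; rewrite mxE -real_normK ?num_real //.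
rewrite lerXn2r ?nnegrE ?normr_ge0 ?sumr_ge0 //.
apply: le_trans (ler_norm_sum _ _ _) _; apply: ler_sum => j _.
rewrite normrM ler_piMr // -sqrtr_sqr (le_trans _ x1) //.
rewrite ler_sqrt; last by apply: sumr_ge0 => k _; apply: sqr_ge0.
by rewrite (bigD1 j) //= lerDl sumr_ge0 // => k _; apply: sqr_ge0.
Qed.

Lemma enormZ (R : realType) n (a : R) (x : 'cV[R]_n) :
  enorm (a *: x) = `|a| * enorm x.
Proof.
rewrite /enorm -sqrtr_sqr -sqrtrM ?sqr_ge0 // mulr_sumr.
by congr Num.sqrt; apply: eq_bigr => i _; rewrite mxE exprMn.
Qed.

Lemma enorm_mulmx_le (R : realType) m n (A : 'M[R]_(m, n)) (x : 'cV[R]_n) :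
  enorm (A *m x) <= opnorm A * enorm x.
Proof.
have [->|x0] := eqVneq x 0.
  by rewrite mulmx0 !enormE /dot !mulmx0 !mxE sqrtr0 mulr0.
have nx : 0 < enorm x.
  by rewrite enormE sqrtr_gt0 lt_def dot_eq0 x0 dot_ge0.
rewrite -ler_pdivrMr // mulrC -[X in X * _]ger0_norm ?invr_ge0 ?(ltW nx) //.
rewrite -enormZ scalemxAr; apply: (ub_le_sup (has_ubound_opnorm A)).
exists ((enorm x)^-1 *: x) => //=.
by rewrite enormZ ger0_norm ?invr_ge0 ?(ltW nx) // mulVf // gt_eqF.
Qed.

Lemma dot_mulmx_le (R : realType) m n (A : 'M[R]_(m, n)) (K : R)
    (x : 'cV[R]_n) : opnorm A <= K ->
  dot (A *m x) (A *m x) <= K ^+ 2 * dot x x.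
Proof.
move=> AK; have Ax : enorm (A *m x) <= K * enorm x.
  by rewrite (le_trans (enorm_mulmx_le _ _)) // ler_wpM2r ?sqrtr_ge0.
have := Ax; rewrite -ler_sqr ?nnegrE ?sqrtr_ge0 //; last first.
  (* Squaring needs [0 <= K * enorm x]; this follows from [Ax] itself, without a sign assumption on
     [K]. *)
  by rewrite (le_trans _ Ax) ?sqrtr_ge0.
by rewrite exprMn !enormE !sqr_sqrtr ?dot_ge0.
Qed.

(** * Estimates for quadratic forms *)

Lemma dot_lincomb (R : realType) n (a : R) (u v : 'cV[R]_n) :
  dot (u + a *: v) (u + a *: v) =
  dot u u + 2 * a * dot u v + a ^+ 2 * dot v v.
Proof.
rewrite !dotE !mulr_sumr -!big_split /=.
by apply: eq_bigr => i _; rewrite !mxE; ring.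
Qed.

(** For [K > 0], expand [|v + K u|^2 >= 0], bound [|v|^2] by [K^2 |u|^2] and divide by [2 K]. For
    [K = 0] the hypothesis forces [v = 0]. *)
Lemma dot_geN (R : realType) n (K : R) (u v : 'cV[R]_n) : 0 <= K ->
  dot v v <= K ^+ 2 * dot u u -> - (K * dot u u) <= dot u v.
Proof.
rewrite le_eqVlt => /orP[/eqP <-|K0] vv.
  suff -> : v = 0 by rewrite mul0r oppr0 /dot mulmx0 mxE.
  apply/eqP; rewrite -dot_eq0 eq_le dot_ge0 andbT.
  by rewrite (le_trans vv) // expr0n mul0r.
have := dot_ge0 (v + K *: u); rewrite dot_lincomb [dot v u]dotC => h.
rewrite -(ler_pM2l K0); nra.
Qed.

Lemma qform_dot (R : realType) n (A : 'M[R]_n) (x : 'cV[R]_n) :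
  qform A x = dot x (A *m x).
Proof. by rewrite /qform /dot mulmxA. Qed.

(** The scalars [x^T J M x] and [x^T M J^T x] are transposes of each other, hence equal, and both
    are the inner product of [M x] with [J^T x]. *)
Lemma qform_lyapunov (R : realType) n (J M P : 'M[R]_n) (c e : R)
    (x : 'cV[R]_n) : M = M^T ->
  qform (- (J *m M) - M *m J^T + c *: P - e%:M) x =
  - 2 * dot (M *m x) (J^T *m x) + c * dot x (P *m x) - e * dot x x.
Proof.
move=> Msym; rewrite qform_dot !mulmxDl !mulNmx -scalemxAl -scalemx1 -scalemxAl.
rewrite mul1mx /dot !mulmxDr !mulmxN -!scalemxAr.
have <- : (x^T *m (J *m M *m x)) 0 0 = ((M *m x)^T *m (J^T *m x)) 0 0.
  transitivity (((M *m x)^T *m (J^T *m x))^T 0 0); last exact: mxE.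
  by rewrite !trmx_mul !trmxK !mulmxA.
have -> : (x^T *m (M *m J^T *m x)) = (x^T *m (J *m M *m x))^T.
  by rewrite !trmx_mul trmxK -Msym !mulmxA.
rewrite !mxE; ring.
Qed.

(* Here [w] stands for a coordinate of [Q *m y]; the difference of the two sides
   is a sum of squares. *)
Lemma lyapunov_pointwise_ge (R : realFieldType) (b lam gam q1 q2 x y z w : R) :
  q1 = b - lam -> q2 = lam * (b ^+ 2 + 1) - 2 * lam + gam * b ->
  (2 * (lam * b) - 1) * y ^+ 2 - 2 * (y * w) - (2 * y - w) ^+ 2
  + 2 * gam * (b ^+ 2 + 1) * z ^+ 2 <=
  - 2 * ((x + y) * w + (x + 2 * y + b * z) * (lam * z - x)
         + (b * y + (b ^+ 2 + 1) * z) * (- lam * y - gam * z))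
  + (2 * lam * b + 2 * (q1 ^+ 2 + q2 ^+ 2) + 1) * z ^+ 2
  - 1 / 2 * (x ^+ 2 + y ^+ 2 + z ^+ 2).
Proof.
(* The cross terms [x * z] and [y * z] carry the coefficients [2 * q1] and [2 * q2]. Half of
   [x ^+ 2] and half of [y ^+ 2] absorb them at the cost of [2 * (q1 ^+ 2 + q2 ^+ 2) * z ^+ 2], and
   [2 * lam * b] cancels the negative [z ^+ 2] term. *)
move=> q1E q2E; rewrite -subr_ge0 [X in 0 <= X](_ : _ =
  (x + (2 * y - w)) ^+ 2 + 1 / 2 * (x + 2 * q1 * z) ^+ 2
  + 1 / 2 * (y + 2 * q2 * z) ^+ 2 + 1 / 2 * z ^+ 2).
  by rewrite !addr_ge0 ?sqr_ge0 // mulr_ge0 ?sqr_ge0 //; lra.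
by rewrite q1E q2E; field.
Qed.

Lemma sum3 (V : nmodType) (F : 'I_3 -> V) : \sum_i F i = F 0 + F 1 + F 2%:R.
Proof.
rewrite !big_ord_recl big_ord0 addr0 addrA.
by congr (_ + F _ + F _); apply: val_inj.
Qed.

Theorem lemma3p1 (R : realType) (d : nat) (lam gam K : R)
    (hd : (1 <= d)%N) (hlam : 0 < lam) (hgam : 0 < gam) (hK : 0 <= K) :
  let b := (K + 1 + (K + 2) ^+ 2) / lam in
  let vs := b ^+ 2 + 1 in
  let q1 := b - lam in
  let q2 := lam * vs - 2 * lam + gam * b in
  let A0 := (2 * lam * b + 2 * (q1 ^+ 2 + q2 ^+ 2) + 1) / gam in
  let M : 'M[R]_(3 * d) :=
    tensmx (mx33 1 1 0
                 1 2 b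
                 0 b vs) (1%:M : 'M[R]_d) in
  let Pz : 'M[R]_(3 * d) :=
    flattenmx (mx33 0 0 0
                    0 0 0
                    0 0 (1%:M : 'M[R]_d)) in
  posdefmx M /\
  forall Q : 'M[R]_d, Q \is symmetricmx -> opnorm Q <= K ->
    let J : 'M[R]_(3 * d) :=
      flattenmx (mx33 0 (- 1%:M) 0
                      Q 0 (- lam%:M)
                      0 lam%:M (- gam%:M)) in
    loewner_ge (- (J *m M) - M *m J^T + (A0 * gam) *: Pz) ((1 / 2)%:M).
Proof.
move=> b vs q1 q2 A0 M Pz.
have Msym : M = M^T.
  rewrite /M trmx_tens trmx1; congr tensmx.
  apply/matrixP => i j; rewrite !mxE.
  by case: i j => [[|[|[]]] ? //] [[|[|[]]] ? //].
have Pzsym : Pz = Pz^T.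
  rewrite /Pz trmx_flattenmx; congr flattenmx; apply/matrixP => i j; rewrite !mxE.
  by case: i j => [[|[|[]]] ? //] [[|[|[]]] ? //]; rewrite /= ?trmx0 ?trmx1.
have MX i X : blk i (M *m X) = \sum_j
    (mx33 1 1 0 1 2 b 0 b vs i j) *: blk j X.
  rewrite /M tensmx1 blk_flattenmx; apply: eq_bigr => j _.
  by rewrite mxE mul_scalar_mx.
have M0 X : blk 0 (M *m X) = blk 0 X + blk 1 X.
  by rewrite MX sum3 !mxE /= !scale1r scale0r addr0.
have M1 X : blk 1 (M *m X) = blk 0 X + 2 *: blk 1 X + b *: blk 2%:R X.
  by rewrite MX sum3 !mxE /= !scale1r.
have M2 X : blk 2%:R (M *m X) = b *: blk 1 X + vs *: blk 2%:R X.
  by rewrite MX sum3 !mxE /= scale0r add0r.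
split.
  split=> [|X X0]; first by rewrite symmetricmxE {1}Msym.
  rewrite qform_dot dot_blk sum3 M0 M1 M2.
  have -> : dot (blk 0 X) (blk 0 X + blk 1 X)
    + dot (blk 1 X) (blk 0 X + 2 *: blk 1 X + b *: blk 2%:R X)
    + dot (blk 2%:R X) (b *: blk 1 X + vs *: blk 2%:R X)
    = dot (blk 0 X + blk 1 X) (blk 0 X + blk 1 X)
    + dot (blk 1 X + b *: blk 2%:R X) (blk 1 X + b *: blk 2%:R X)
    + dot (blk 2%:R X) (blk 2%:R X).
    rewrite !dotE -!big_split /=; apply: eq_bigr => i _; rewrite !mxE /vs; ring.
  rewrite lt_def !addr_ge0 ?dot_ge0 // andbT.
  (* All three squares vanish, which gives [z = 0], then [y = 0], then [x = 0]. *)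
  apply: contra X0; rewrite !paddr_eq0 ?addr_ge0 ?dot_ge0 // !dot_eq0.
  move=> /andP[/andP[/eqP xy /eqP yz] /eqP z0].
  have y0 : blk 1 X = 0 by rewrite z0 scaler0 addr0 in yz.
  have x0 : blk 0 X = 0 by rewrite y0 addr0 in xy.
  apply/eqP/blk_eq0 => i.
  (* This sum selects block [i], which avoids a case analysis on the index. *)
  have : \sum_j (i == j)%:R *: blk j X = 0 by rewrite sum3 x0 y0 z0 !scaler0 !addr0.
  rewrite (bigD1 i) //= eqxx scale1r big1 ?addr0 // => j.
  by rewrite eq_sym => /negPf ->; rewrite scale0r.
move=> Q; rewrite symmetricmxE => /eqP Qsym QK J.
have JT : J^T = flattenmx (mx33 0 Q 0 (- 1%:M) 0 lam%:M 0 (- lam%:M) (- gam%:M)).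
  rewrite /J trmx_flattenmx; congr flattenmx; apply/matrixP => i j; rewrite !mxE.
  by case: i j => [[|[|[]]] ? //] [[|[|[]]] ? //] /=;
     rewrite ?linearN /= ?trmx0 ?tr_scalar_mx -?Qsym.
have lb : lam * b = K + 1 + (K + 2) ^+ 2 by rewrite /b mulrCA divff ?mulr1 // gt_eqF.
split.
- rewrite symmetricmxE; apply/eqP.
  (* Transposition exchanges [J *m M] and [M *m J^T]. *)
  rewrite !linearD !linearN /= linearZ /= !trmx_mul trmxK -Msym -Pzsym.
  by rewrite [- (J *m M) - _]addrC.
- by rewrite symmetricmxE tr_scalar_mx.
split.
  rewrite symmetricmxE; apply/eqP.
  rewrite !linearD !linearN /= linearZ /= tr_scalar_mx !trmx_mul trmxK -Msym -Pzsym.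
  by rewrite [- (J *m M) - _]addrC.
move=> X; rewrite qform_lyapunov //.
have -> : A0 * gam = 2 * lam * b + 2 * (q1 ^+ 2 + q2 ^+ 2) + 1.
  by rewrite /A0 divfK // gt_eqF.
set x := blk 0 X; set y := blk 1 X; set z := blk 2%:R X; set w := Q *m y.
have JT0 : blk 0 (J^T *m X) = w.
  by rewrite JT blk_flattenmx sum3 !mxE /= !mul0mx addr0 add0r.
have JT1 : blk 1 (J^T *m X) = lam *: z - x.
  by rewrite JT blk_flattenmx sum3 !mxE /= mul0mx addr0 mulNmx mul1mx mul_scalar_mx addrC.
have JT2 : blk 2%:R (J^T *m X) = - lam *: y - gam *: z.
  by rewrite JT blk_flattenmx sum3 !mxE /= mul0mx add0r !mulNmx !mul_scalar_mx scaleNr.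
have Pz0 : dot X (Pz *m X) = dot z z.
  by rewrite dot_blk !sum3 !blk_flattenmx !sum3 !mxE /= !mul0mx !addr0 !add0r
     mul1mx !dotr0 !add0r.
have ww := dot_mulmx_le y QK.
have yw := dot_geN hK ww.
have yy := dot_ge0 y; have zz := dot_ge0 z.
(* The pointwise inequality summed over coordinates; the parenthesis on the left is [|2 y - w|^2]
   expanded. *)
have : (2 * (lam * b) - 1) * dot y y - 2 * dot y w
  - (4 * dot y y - 4 * dot y w + dot w w) + 2 * gam * vs * dot z z <=
  - 2 * dot (M *m X) (J^T *m X)
  + (2 * lam * b + 2 * (q1 ^+ 2 + q2 ^+ 2) + 1) * dot X (Pz *m X)
  - 1 / 2 * dot X X.
  rewrite Pz0 [dot X X]dot_blk dot_blk !sum3 JT0 JT1 JT2 M0 M1 M2 -/x -/y -/z.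
  rewrite !dotE !mulrDr !mulr_sumr !opprD -!sumrN -!big_split /=.
  clearbody w x y z.
  apply: ler_sum => i _.
  have := lyapunov_pointwise_ge (x i 0) (y i 0) (z i 0) (w i 0)
    erefl (erefl q2).
  (* Replacing [b ^+ 2] by [vs - 1] makes both inequalities use the same monomials. *)
  rewrite !mxE -/q1 -/vs -[b ^+ 2](addrK 1) -/vs. lra.
move=> lower; apply: le_trans lower; rewrite addr_ge0 //; last first.
  by rewrite !mulr_ge0 // ?(ltW hgam) // /vs addr_ge0 ?sqr_ge0.
(* The remaining terms are [(2 lam b - 5) |y|^2 + 2 <y, w> - |w|^2]. By [yw], [ww] and [lb] they are
   at least [(K^2 + 8 K + 5) |y|^2]. *)
have KN := mulr_ge0 hK yy; have KKN := mulr_ge0 (sqr_ge0 K) yy.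
rewrite lb -/w in ww yw *; lra.
Qed.
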